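(* Let $m \geq 1$ and $k \geq 3$ be integers and let $$n=2^{2m+k+7} + 2^{2m+k+5} + 2^{m+k+4} + 2^{m+k+3} + 2^{m+2} + 2^{m+1} + 1.$$ Then $\ell(2^n-1) \leq \ell(n) + n - 1$; that is, the Scholz conjecture on addition chains holds for $n$.
   Context: An addition chain for a positive integer $n$ is a finite sequence $a_0=1, a_1, a_2, \ldots, a_r$ of positive integers with $a_r = n$ such that every element $a_k$ with $k \geq 1$ is the sum $a_i + a_j$ of two previous elements ($0 \le i, j < k$, with $i=j$ allowed). The integer $r$ is the length of the chain. For a positive integer $n$, $\ell(n)$ denotes the minimal length of all addition chains for $n$. The Scholz conjecture is said to hold for a positive integer $n$ if $\ell(2^n-1) \leq \ell(n) + n - 1$. *)

(* Defs.v *)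
(* Plain MathComp over nat; boolp is used only to make [ell] a total function. *)
From mathcomp Require Import all_boot.
From mathcomp Require Import boolp.

Set Implicit Arguments.
Unset Strict Implicit.
Unset Printing Implicit Defensive.

(* The list [a] is a_0, ..., a_r: a chain of length r has r + 1
   terms. It is not required to be increasing, and i = j is allowed. *)
Definition addition_chain (n r : nat) (a : seq nat) : Prop :=
  [/\ size a = r.+1,
      (forall k, k <= r -> 0 < nth 0 a k),
      nth 0 a 0 = 1,
      nth 0 a r = n
    & forall k, 1 <= k <= r ->
        exists i j, [/\ i < k, j < k & nth 0 a k = nth 0 a i + nth 0 a j]].

Definition has_addition_chain (n r : nat) : Prop :=
  exists a, addition_chain n r a.

Lemma has_addition_chain_pred (n : nat) : 0 < n -> has_addition_chain n n.-1.
Proof.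
case: n => // n _; exists (iota 1 n.+1); split.
- by rewrite size_iota.
- by move=> k kn; rewrite nth_iota.
- by [].
- by rewrite nth_iota // add1n.
- case=> // k /andP[_ kn]; exists k, 0; split=> //.
  by rewrite !nth_iota ?add1n ?addn1 // ltnW.
Qed.

(* 0 has no addition chain; the first disjunct makes [ell 0] the junk value 0. *)
Lemma ell_subproof (n : nat) :
  exists r, (n == 0) || `[< has_addition_chain n r >].
Proof.
exists n.-1; case: n => //= n; apply/asboolP.
exact: (@has_addition_chain_pred n.+1).
Qed.

Definition ell (n : nat) : nat := ex_minn (ell_subproof n).

Lemma ell_chain (n : nat) : 0 < n -> has_addition_chain n (ell n).
Proof.
by rewrite /ell lt0n => /negPf n0; case: ex_minnP => r; rewrite n0 => /asboolP.
Qed.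

Lemma ell_min (n r : nat) : has_addition_chain n r -> ell n <= r.
Proof.
move=> nr; rewrite /ell; case: ex_minnP => l _; apply.
by apply/orP; right; apply/asboolP.
Qed.

(* Main.v *)
Require Import Defs.
From mathcomp Require Import all_boot.
From mathcomp Require Import zify.

(* Put E = 2m + k + 5, so that n is odd and lies between 5 * 2^E + 2 and
   10 * 2^E. The star chain through 1, 2, 3, 5 that successively appends the
   blocks 11, 11, 1 of binary digits has length E + 6, and Brauer's construction
   settles the case ell n >= E + 6.

   Otherwise take a chain of length r <= E + 5 and call trunk the path from n
   down to 1 along the larger summands. If the trunk has T steps then
   5 * 2^E < n <= 2^T, so at most two elements, the sides, are off the trunk. In
   Brauer's construction a side c + d costs a single extra addition as soon as c
   is on the trunk and the next trunk element is at least c + d (the side is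
   then free). A side used at most once as an addend can be absorbed into the
   trunk. A side used twice forces so much growth to be lost, in comparison with
   n > (5/4) * 2^(E + 2), that almost all trunk steps are doublings: this is
   impossible for the last of two sides, and makes a single side free, possibly
   after exchanging it with a trunk element. *)

(** * Trunks *)

(* [s] lists the addends of a trunk that starts at [u]. The list [E] of available
   elements contains the side elements from the start: since an addend is at
   most the current top, none is used before its summands are on the trunk. *)
Fixpoint run (E : seq nat) (u : nat) (s : seq nat) : bool :=
  if s is b :: s' then
    [&& b \in E, b <= u & run (u + b :: E) (u + b) s']
  else true.

Lemma run_sub E F u s :
  (forall b, b \in s -> b \in E -> b \in F) -> run E u s -> run F u s.
Proof.
elim: s E F u => //= b s IH E F u sEF /and3P[bE -> r].
rewrite sEF ?mem_head //=; apply: IH r => x xs.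
by rewrite !inE => /orP[->//|xE]; rewrite (sEF x) ?orbT // inE xs orbT.
Qed.

Lemma run_cat E u s1 s2 :
  run E u (s1 ++ s2) =
  run E u s1 && run (scanl addn u s1 ++ E) (u + sumn s1) s2.
Proof.
elim: s1 E u => [|b s1 IH] E u /=; first by rewrite addn0.
rewrite IH -!andbA addnA; do 3!congr (_ && _).
by apply/idP/idP; apply: run_sub => x _; rewrite !(inE, mem_cat) orbCA.
Qed.

Lemma run_leq E u s : run E u s -> u + sumn s <= 2 ^ size s * u.
Proof.
elim: s E u => [|b s IH] E u /=; first by rewrite addn0 mul1n.
by case/and3P=> _ bu /IH; rewrite expnS; nia.
Qed.

(** The growth is largest when the [m] additions of [w] come first and every other step doubles the
    top, since a later doubling also doubles what was added before. *)
Lemma run_leq_count E u s w m :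
  run E u s -> m <= count_mem w s ->
  2 ^ m * (u + sumn s) <= 2 ^ size s * (u + m * w).
Proof.
elim: s E u m => [|b s IH] E u m /=.
  by rewrite leqn0 => _ /eqP->; rewrite mul0n !addn0.
case/and3P=> _ bu r; case: eqP => [bw|_] /=; first subst b.
- case: m => [_|m].
    by move: (IH _ _ 0 r isT); rewrite mul0n expnS addnA; nia.
  rewrite ltnS => /(IH _ _ _ r) h.
  by rewrite !expnS -!mulnA leq_mul2l mulSn !addnA.
- move=> /(IH _ _ _ r) h; rewrite expnS addnA (leq_trans h) //.
by rewrite [2 * _]mulnC -mulnA leq_mul2l; lia.
Qed.

(* Number of steps that are not doublings. *)
Fixpoint nd (u : nat) (s : seq nat) : nat :=
  if s is b :: s' then (b != u) + nd (u + b) s' else 0.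

(* Largest value reached by [k] consecutive nondoublings from the top [u] when all
   other elements are at most [p]. *)
Fixpoint fibn (k p u : nat) : nat :=
  if k is k'.+1 then fibn k' u (u + p) else u.

Lemma leq_fibn k p q u v : p <= q -> u <= v -> fibn k p u <= fibn k q v.
Proof. by elim: k p q u v => //= k IH p q u v pq uv; apply: IH; lia. Qed.

Lemma fibnM a k p u : fibn k (a * p) (a * u) = a * fibn k p u.
Proof. by elim: k p u => //= k IH p u; rewrite -mulnDr IH. Qed.

(** Nondoublings also cost least at the start. Doubling first turns the pair ([p], [u]) of the bound
    on the other elements and the top into ([u], [2 * u]), which is at most twice the old pair
    because [u <= 2 * p]. *)
Lemma run_leq_fibn E p u s k :
  run E u s -> {in E, forall e, e <> u -> e <= p} -> p <= u <= 2 * p ->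
  k <= nd u s -> 2 ^ k * (u + sumn s) <= 2 ^ size s * fibn k p u.
Proof.
elim: s E p u k => [|b s IH] E p u k /=.
  by move=> _ _ _; rewrite leqn0 => /eqP->; rewrite addn0.
case/and3P=> bE bu r Ep /andP[pu up].
have E'u : {in u + b :: E, forall e, e <> u + b -> e <= u}.
  move=> e; rewrite inE => /predU1P[->//|eE] _.
  by case: (eqVneq e u) => [->//|/eqP/(Ep _ eE)]; lia.
have ub : u <= u + b <= 2 * u by lia.
rewrite addnA expnS -mulnA; case: (eqVneq b u) => [bEu|/eqP bNu] /=.
  rewrite add0n => /(IH _ _ _ _ r E'u ub)/leq_trans->//.
  rewrite mulnCA leq_mul2l -fibnM; apply/orP; right.
  by apply: leq_fibn; lia.
have bp := Ep _ bE bNu.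
case: k => [_|k].
  by rewrite /= mul1n mulnCA (leq_trans (run_leq _ _ _ r)) // leq_mul2l; lia.
rewrite add1n ltnS => /(IH _ _ _ _ r E'u ub) h.
rewrite expnS -mulnA leq_mul2l (leq_trans h) //= leq_mul2l.
by apply/orP; right; apply: leq_fibn; lia.
Qed.

Lemma nd_eq0 u s : nd u s = 0 -> u + sumn s = 2 ^ size s * u.
Proof.
elim: s u => [|b s IH] u /=; first by rewrite addn0 mul1n.
by case: eqVneq => //= -> /IH; rewrite expnS; lia.
Qed.

Lemma mem_nd_gt0 u s w : w < u -> w \in s -> 0 < nd u s.
Proof.
elim: s u => //= b s IH u wu; rewrite inE => /predU1P[<-|/IH]; first by lia.
by move=> /(_ (u + b)); lia.
Qed.

Lemma nd_leq1 u s w : w < u -> w \in s -> nd u s <= 1 ->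
  exists j i, size s = j + i.+1 /\ u + sumn s = 2 ^ i * (2 ^ j * u + w).
Proof.
elim: s u => //= b s IH u wu; case: (eqVneq b u) => [->|bu] /=.
  rewrite inE => /predU1P[|ws]; first by lia.
  rewrite add0n => /(IH (u + u)) [||j [i [-> e]]]; rewrite ?ltn_addr //.
  by exists j.+1, i; split; rewrite ?addSn // addnA e expnS; lia.
rewrite add1n ltnS leqn0 inE => /predU1P[->|ws] /eqP nd0.
  by exists 0, (size s); rewrite addnA nd_eq0 //; split; lia.
by have := mem_nd_gt0 (u + b) s w; rewrite nd0 ltn_addr // ws => /(_ isT isT).
Qed.

(** With three nondoublings, [fibn 3 p u = 3 * u + 2 * p] gives the second alternative. Otherwise
    the only two are the additions of [w]: oddness forbids doublings after the second, and a
    doubling between them already loses enough growth. *)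
Lemma run_tail E p u w s :
  run E u (w :: s) -> {in E, forall e, e <> u -> e <= p} -> p <= u <= 2 * p ->
  w < u -> w \in s -> odd (u + sumn (w :: s)) ->
  u + sumn (w :: s) = u + 2 * w \/
  8 * (u + sumn (w :: s)) <= 2 ^ size (w :: s) * (3 * u + 2 * p).
Proof.
move=> r Ep pu wu ws no.
case: (leqP 3 (nd u (w :: s))) => [n3|].
  right; have := run_leq_fibn _ _ _ _ _ r Ep pu n3.
  by congr (_ <= _ * _); rewrite /=; lia.
have wp : w <= p by apply: Ep; [case/and3P: r | lia].
rewrite [nd _ _]/= (_ : w != u); last by lia.
rewrite add1n !ltnS => /(nd_leq1 _ _ _ _ ws) [|j [i [sz e]]].
  by case/and3P: r; lia.
move: no; rewrite /= addnA e.
case: i e sz => [|i] e sz; last by rewrite expnS -mulnA oddM.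
case: j e sz => [|j] e sz _; first by left; lia.
by right; rewrite sz addn1 !expnS; nia.
Qed.

Lemma scanlP u s x :
  reflect (exists s1 s2, s = s1 ++ s2 /\ x = u + sumn s1)
          (x \in u :: scanl addn u s).
Proof.
apply: (iffP idP) => [|[s1 [s2 [-> ->]]]].
  elim: s u => [|b s IH] u /=.
    by rewrite inE => /eqP->; exists [::], [::]; rewrite addn0.
  rewrite inE => /predU1P[->|/IH[s1 [s2 [-> ->]]]].
    by exists [::], (b :: s); rewrite addn0.
  by exists (b :: s1), s2; rewrite /= addnA.
elim: s1 u => [|b s1 IH] u /=; first by rewrite addn0 mem_head.
by rewrite inE addnA IH orbT.
Qed.

Lemma scanl_geq u s x : x \in u :: scanl addn u s -> u <= x.
Proof. by case/scanlP=> s1 [s2 [_ ->]]; apply: leq_addr. Qed.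

Lemma mem_scanl_top u s : u + sumn s \in u :: scanl addn u s.
Proof. by apply/scanlP; exists s, [::]; rewrite cats0. Qed.

Lemma run_pos E u s : run E u s -> 0 < u -> 0 \notin E -> 0 \notin s.
Proof.
elim: s E u => //= b s IH E u /and3P[bE bu r] u0 E0.
rewrite inE negb_or (IH _ _ r) ?inE ?negb_or ?E0 ?andbT; try by lia.
by apply: contraNneq E0 => ->.
Qed.

Lemma scanl_leq u s1 s2 x :
  0 \notin s2 -> x \in u :: scanl addn u (s1 ++ s2) -> x <= u + sumn s1 ->
  x \in u :: scanl addn u s1.
Proof.
elim: s1 u => [|b s1 IH] u s20 /=; last first.
  rewrite inE addnA => /predU1P[->|]; first by rewrite mem_head.
  by move=> /(IH _ s20)/[apply] h; rewrite inE h orbT.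
rewrite addn0 => xs xu; rewrite inE eqn_leq xu /=.
exact: scanl_geq xs.
Qed.

Lemma scanl_addn_cat u s1 s2 :
  scanl addn u (s1 ++ s2) = scanl addn u s1 ++ scanl addn (u + sumn s1) s2.
Proof. by elim: s1 u => [|b s1 IH] u /=; rewrite ?addn0 // IH addnA. Qed.

(* The side elements are listed latest first. *)
Fixpoint built (T W : seq nat) : Prop :=
  if W is w :: W' then
    (exists c d, [/\ c \in W' ++ T, d \in W' ++ T & w = c + d]) /\ built T W'
  else True.

Lemma built_sub T T' W : {subset T <= T'} -> built T W -> built T' W.
Proof.
move=> TT'; elim: W => //= w W IH [[c [d [cW dW wE]]] /IH]; split=> //.
exists c, d; rewrite wE; split=> //; move: cW dW; rewrite !mem_cat.
  by case/orP=> [->//|/TT'->]; rewrite orbT.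
by move=> _ /orP[->//|/TT'->]; rewrite orbT.
Qed.

(* Following larger summands back from [a_k] gives the trunk; all other elements
   of index at most [k] become sides. *)
Lemma trunk_of_chain n r a k : addition_chain n r a -> k <= r ->
  exists s W, [/\ run (1 :: W) 1 s, 1 + sumn s = nth 0 a k,
    size s + size W = k, built (1 :: scanl addn 1 s) W &
    forall i, i <= k -> nth 0 a i \in W ++ 1 :: scanl addn 1 s].
Proof.
case=> _ _ a0 _ astep.
elim/ltn_ind: k => -[_ _|k IH kr].
  by exists [::], [::]; split=> // i; rewrite leqn0 => /eqP->; rewrite a0.
have [|i [j [ik jk aE]]] := astep k.+1; first by rewrite kr.
wlog aji : i j ik jk aE / nth 0 a j <= nth 0 a i.
  move=> H; case/orP: (leq_total (nth 0 a j) (nth 0 a i)); first exact: H aE.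
  by apply: H jk ik _; rewrite addnC.
(* The trunk belongs to the larger summand [a_i]; the elements of index [i + 1] to [k] are adjoined
   one by one as sides, so that [a_j] is available too. *)
have [s [W [r1 sE sz bW mW]]] : exists s W, [/\ run (1 :: W) 1 s,
    1 + sumn s = nth 0 a i, size s + size W = k, built (1 :: scanl addn 1 s) W &
    forall l, l <= k -> nth 0 a l \in W ++ 1 :: scanl addn 1 s].
  rewrite ltnS in ik; rewrite -(subnKC ik).
  have : i + (k - i) <= k by lia.
  elim: (k - i) => [_|q IHq qk].
    by rewrite addn0; apply: IH; lia.
  have [|s [W [r1 sE sz bW mW]]] := IHq; first by lia.
  have [|i' [j' [ik' jk' aE']]] := astep (i + q).+1; first by lia.
  exists s, (nth 0 a (i + q).+1 :: W); split; rewrite ?sE //.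
  - by apply: run_sub r1 => x _; rewrite !inE => /orP[->|->]; rewrite ?orbT.
  - by move: sz => /=; lia.
  - by split=> //; exists (nth 0 a i'), (nth 0 a j'); split=> //; apply: mW.
  - move=> l; rewrite addnS leq_eqVlt => /predU1P[->|ll].
      by rewrite mem_head.
    by rewrite inE mW ?orbT.
exists (s ++ [:: nth 0 a j]), W; split.
- rewrite run_cat r1 /= sE aji !andbT.
  by have := mW _ (jk : j <= k); rewrite !(inE, mem_cat) orbCA orbA orbC.
- by rewrite sumn_cat /= addn0 addnA sE -aE.
- by rewrite size_cat /=; lia.
- apply: built_sub bW => x; rewrite scanl_addn_cat /= !(inE, mem_cat).
  by case/orP=> ->; rewrite ?orbT.
- move=> l; rewrite leq_eqVlt scanl_addn_cat /= => /predU1P[->|ll].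
    by rewrite !(inE, mem_cat) aE -sE eqxx !orbT.
  have := mW _ (ll : l <= k); rewrite !(inE, mem_cat).
  by case/or3P=> ->; rewrite ?orbT.
Qed.

(** * Chains for 2^n - 1 *)

(* Addition chains as reversed lists. *)
Inductive ac : seq nat -> Prop :=
| ac1 : ac [:: 1]
| acD L (x y : nat) : ac L -> x \in L -> y \in L -> ac (x + y :: L).

Lemma ac_chain L : ac L ->
  0 < size L /\ addition_chain (head 0 L) (size L).-1 (rev L).
Proof.
elim=> [|M x y _ [M0 [sz pos n0 _ st]] xM yM].
  by split=> //; split=> // -[] // k; rewrite ltn0 andbF.
have idx z : z \in M -> exists2 i, i < size M & nth 0 (rev M) i = z.
  move=> zM; exists (index z (rev M)); first by rewrite -size_rev index_mem mem_rev.
  by rewrite nth_index ?mem_rev.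
have [i iM xE] := idx _ xM; have [j jM yE] := idx _ yM.
split=> //=; rewrite rev_cons; split.
- by rewrite size_rcons size_rev.
- move=> k kM; rewrite nth_rcons size_rev; case: (ltnP k (size M)) => kM'.
    by apply: pos; lia.
  rewrite ifT; last by lia.
  by rewrite -xE ltn_addr // pos; lia.
- by rewrite nth_rcons size_rev M0.
- by rewrite nth_rcons size_rev ltnn eqxx.
- move=> k /andP[k0 kM]; case: (ltnP k (size M)) => kM'.
    have [|i' [j' [ik jk kE]]] := st k; first by lia.
    exists i', j'; rewrite !nth_rcons size_rev kM' !ifT ?(ltn_trans _ kM') //.
  have {kM kM'} -> : k = size M by lia.
  by exists i, j; rewrite !nth_rcons size_rev iM jM ltnn eqxx xE yE.
Qed.

Lemma ac_ell L x : ac L -> x \in L -> ell x <= (size L).-1.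
Proof.
move=> acL; elim: acL x => [x|M x y acM IH xM yM z].
  rewrite inE => /eqP->; apply: ell_min.
  by exists [:: 1]; have [] := ac_chain _ ac1.
rewrite inE => /predU1P[->|/IH h]; last by rewrite (leq_trans h) // leq_pred.
apply: ell_min; exists (rev (x + y :: M)).
by have [] := ac_chain _ (acD _ _ _ acM xM yM).
Qed.

Lemma ac_shift L x b : ac L -> x \in L ->
  exists L', [/\ ac L', {subset L <= L'}, size L' = size L + b &
    forall i, i <= b -> 2 ^ i * x \in L'].
Proof.
move=> acL xL; elim: b => [|b [M [acM LM sz pw]]].
  by exists L; rewrite addn0; split=> // i; rewrite leqn0 => /eqP->; rewrite mul1n.
have bM := pw _ (leqnn b).
exists (2 ^ b * x + 2 ^ b * x :: M); split.
- exact: acD.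
- by move=> y /LM; rewrite inE orbC => ->.
- by rewrite /= sz addnS.
- move=> i; rewrite leq_eqVlt => /predU1P[->|/pw]; rewrite inE.
    by rewrite expnS -mulnA mul2n addnn eqxx.
  by rewrite orbC => ->.
Qed.

Lemma exp2_sub1D u b : 2 ^ (u + b) - 1 = 2 ^ b * (2 ^ u - 1) + (2 ^ b - 1).
Proof. by rewrite expnD; have := expn_gt0 2 u; have := expn_gt0 2 b; nia. Qed.

(** Brauer's construction: by [exp2_sub1D], a trunk step from [u] to [u + b] costs [b] doublings of
    [2 ^ u - 1] and one addition of [2 ^ b - 1]. *)
Lemma ac_run E u s L :
  run E u s -> ac L -> u \in E -> {in E, forall e, 2 ^ e - 1 \in L} ->
  exists L', [/\ ac L', {subset L <= L'},
    size L' = size L + (sumn s + size s) &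
    {in u :: scanl addn u s, forall e, 2 ^ e - 1 \in L'}].
Proof.
elim: s E u L => [|b s IH] E u L /=.
  move=> _ acL uE EL; exists L; rewrite !addn0; split=> // e.
  by rewrite inE => /eqP->; apply: EL.
case/and3P=> bE bu r acL uE EL.
have [M [acM LM sz pw]] := ac_shift _ _ b acL (EL _ uE).
have acM' := acD _ _ _ acM (pw _ (leqnn b)) (LM _ (EL _ bE)).
rewrite -exp2_sub1D in acM'.
have [|e|L' [acL' ML' sz' scL']] := IH _ _ _ r acM'; first exact: mem_head.
  by rewrite !inE => /predU1P[->|/EL/LM->]; rewrite ?eqxx ?orbT.
exists L'; split=> //.
- by move=> x xL; apply: ML'; rewrite inE LM ?orbT.
- by rewrite sz' /= sz; lia.
- move=> e; rewrite inE => /predU1P[->|]; last exact: scL'.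
  by apply: ML'; rewrite inE LM ?orbT // EL.
Qed.

Lemma scholz_star s :
  run [:: 1] 1 s -> ell (2 ^ (1 + sumn s) - 1) <= sumn s + size s.
Proof.
move=> r; have [|L [acL _ sz]] := ac_run _ _ _ _ r ac1 (mem_head _ _).
  by move=> e; rewrite !inE => /eqP->.
by move=> /(_ _ (mem_scanl_top 1 s))/(ac_ell _ _ acL); rewrite sz.
Qed.

(* The doublings [2 ^ i * (2 ^ c - 1)] with [i <= b], needed for the trunk step
   [c -> c + b], also serve the side element [c + d]. *)
Lemma scholz_side s1 b s2 c d :
  run [:: 1; c + d] 1 (s1 ++ b :: s2) -> c = 1 + sumn s1 ->
  d \in 1 :: scanl addn 1 s1 -> d <= b ->
  ell (2 ^ (1 + sumn (s1 ++ b :: s2)) - 1) <=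
  sumn (s1 ++ b :: s2) + size (s1 ++ b :: s2) + 1.
Proof.
move=> r cE ds1 db; have d0 := scanl_geq _ _ _ ds1.
have bound x t : x \in t -> x <= sumn t.
  by elim: t => //= y t IH; rewrite inE => /predU1P[->|/IH]; lia.
move: r; rewrite run_cat => /andP[r1 /= /and3P[bE bu r2]].
have {}r1 : run [:: 1] 1 s1.
  apply: run_sub r1 => x /bound xs; rewrite !inE.
  by case/orP=> // /eqP xE; lia.
have [|L [acL _ sz scL]] := ac_run _ _ _ _ r1 ac1 (mem_head _ _).
  by move=> e; rewrite !inE => /eqP->.
have cL : 2 ^ c - 1 \in L.
  by apply: scL; rewrite cE mem_scanl_top.
have [M [acM LM szM pw]] := ac_shift _ _ b acL cL.
have acM' := acD _ _ _ acM (pw _ db) (LM _ (scL _ ds1)).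
rewrite -exp2_sub1D in acM'.
have bM : 2 ^ b - 1 \in 2 ^ (c + d) - 1 :: M.
  move: bE; rewrite mem_cat !inE => /or3P[bE|/eqP->|/eqP->].
  - by rewrite LM ?orbT // scL // inE bE orbT.
  - by rewrite LM ?orbT // scL // mem_head.
  - by rewrite eqxx.
have cM : 2 ^ b * (2 ^ c - 1) \in 2 ^ (c + d) - 1 :: M.
  by rewrite inE pw ?orbT.
have acN := acD _ _ _ acM' cM bM; rewrite -exp2_sub1D in acN.
rewrite -cE in r2.
have [|N [acN' _ szN]] := ac_run _ _ _ _ r2 acN (mem_head _ _).
  move=> e; rewrite !(inE, mem_cat) => /or4P[/eqP->|es|/eqP->|/eqP->].
  - by rewrite eqxx.
  - by rewrite LM ?orbT // scL // inE es orbT.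
  - by rewrite LM ?orbT // scL // mem_head.
  - by rewrite eqxx orbT.
move=> /(_ _ (mem_scanl_top _ s2))/(ac_ell _ _ acN').
by rewrite szN /= szM sz !sumn_cat size_cat /= cE !addnA /=; lia.
Qed.

(** * Removing a side element *)

(** If a side equals the trunk element [u + sumn s1] and is not added before that element is
    reached, every use of it can refer to the trunk instead. *)
Lemma run_dup E F u s1 s2 :
  run E u (s1 ++ s2) -> u \in F -> u + sumn s1 \notin s1 ->
  {subset E <= u + sumn s1 :: F} -> run F u (s1 ++ s2).
Proof.
move=> r uF ws1 EF; move: r; rewrite !run_cat => /andP[r1 r2].
apply/andP; split.
  apply: run_sub r1 => x xs /EF; rewrite inE => /predU1P[xE|//].
  by rewrite xE in xs; rewrite xs in ws1.
apply: run_sub r2 => x _; rewrite !mem_cat => /orP[->//|/EF].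
rewrite inE => /predU1P[->|->]; last by rewrite orbT.
have := mem_scanl_top u s1; rewrite inE => /predU1P[->|->//].
by rewrite uF orbT.
Qed.

(* A side [c + d] used only once is absorbed into the trunk by adding [c], then
   [d]. *)
Lemma run_split E F u s1 s2 c d :
  run E u (s1 ++ c + d :: s2) -> c + d \notin s1 -> c + d \notin s2 ->
  {subset E <= c + d :: F} -> c \in scanl addn u s1 ++ F ->
  d \in scanl addn u s1 ++ F -> run F u (s1 ++ c :: d :: s2).
Proof.
move=> r w1 w2 EF cF dF; move: r; rewrite !run_cat /= => /and4P[r1 wE wu r2].
have sE (x : nat) (t : seq nat) : x \in t -> c + d \notin t -> x \in E -> x \in F.
  move=> xt wt /EF; rewrite inE => /predU1P[xE|//].
  by rewrite -xE xt in wt.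
apply/and5P; split; rewrite ?inE ?dF ?orbT //; try by lia.
- by apply: run_sub r1 => x /sE; apply.
- apply/andP; split; first by lia.
  rewrite -addnA; apply: run_sub r2 => x xs; rewrite !(inE, mem_cat).
  by case/or3P=> [->//|->|/(sE _ _ xs w2)->]; rewrite ?orbT.
Qed.

(** * Trunks with few nondoublings *)

Lemma nd_cat u s1 s2 : nd u (s1 ++ s2) = nd u s1 + nd (u + sumn s1) s2.
Proof. by elim: s1 u => [|b s1 IH] u /=; rewrite ?addn0 // IH !addnA. Qed.

Lemma nd0_mem u s x : nd u s = 0 ->
  reflect (exists2 i, i <= size s & x = 2 ^ i * u) (x \in u :: scanl addn u s).
Proof.
move=> nd0; apply: (iffP (scanlP _ _ _)) => [[s1 [s2 [sE ->]]]|[i is_ ->]].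
  exists (size s1); first by rewrite sE size_cat leq_addr.
  by apply: nd_eq0; move: nd0; rewrite sE nd_cat; lia.
exists (take i s), (drop i s); split; first by rewrite cat_take_drop.
rewrite nd_eq0 ?size_takel //.
by move: nd0; rewrite -{1}(cat_take_drop i s) nd_cat; lia.
Qed.

Lemma nd_split u s : nd u s = 0 \/
  exists s1 b s2, [/\ s = s1 ++ b :: s2, nd u s1 = 0 & b != 2 ^ size s1 * u].
Proof.
elim: s u => [|b s IH] u /=; first by left.
case: (eqVneq b u) => [->|bu] /=; last first.
  by right; exists [::], b, s; rewrite mul1n.
case: (IH (u + u)) => [->|[s1 [g [s2 [-> nd0 gN]]]]]; first by left.
right; exists (u :: s1), g, s2; split; rewrite //= ?eqxx //.
by move: gN; rewrite addnn -mul2n mulnA expnSr.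
Qed.

(** Before the first nondoubling the trunk consists of powers of two, so the addend is a side or a
    power of two below the top. *)
Lemma run_nd_mem W s1 b s2 : run (1 :: W) 1 (s1 ++ b :: s2) ->
  nd 1 s1 = 0 -> b != 2 ^ size s1 * 1 ->
  [/\ b < 2 ^ size s1, 1 + sumn s1 = 2 ^ size s1 &
    b \in W \/ exists2 i, i < size s1 & b = 2 ^ i].
Proof.
move=> r nd0 bN; have top := nd_eq0 _ _ nd0; rewrite muln1 in top bN.
move: r; rewrite run_cat /= top => /and4P[_ bE bu _]; split=> //.
  by rewrite ltn_neqAle bN.
move: bE; rewrite mem_cat inE orbA => /orP[bE|->]; last by left.
right; have : b \in 1 :: scanl addn 1 s1 by rewrite inE orbC.
case/(nd0_mem _ _ _ nd0) => i iA bE'; exists i; last by rewrite bE' muln1.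
by rewrite ltn_neqAle iA andbT; apply: contraNneq bN => <-; rewrite bE' muln1.
Qed.

Lemma run_nd_mem2 W s1 b s3 g s4 :
  run (1 :: W) 1 (s1 ++ b :: s3 ++ g :: s4) ->
  nd 1 s1 = 0 -> nd (1 + sumn s1 + b) s3 = 0 ->
  g != 2 ^ size s3 * (1 + sumn s1 + b) ->
  [\/ g \in W, exists2 i, i <= size s1 & g = 2 ^ i
    | exists2 i, i < size s3 & g = 2 ^ i * (1 + sumn s1 + b)].
Proof.
move=> r nd1 nd3 gN.
move: r; rewrite run_cat /= run_cat /= => /and4P[_ _ _ /and4P[_ gE gu _]].
move: gE; rewrite mem_cat inE orbA => /orP[gE|].
  have : g \in 1 + sumn s1 + b :: scanl addn (1 + sumn s1 + b) s3.
    by rewrite inE orbC.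
  case/(nd0_mem _ _ _ nd3) => i iA gE'; apply: Or33; exists i => //.
  by rewrite ltn_neqAle iA andbT; apply: contraNneq gN => <-; rewrite gE'.
rewrite mem_cat inE orbA => /orP[gE|]; last by apply: Or31.
apply: Or32; have : g \in 1 :: scanl addn 1 s1 by rewrite inE orbC.
by case/(nd0_mem _ _ _ nd1) => i iA ->; exists i; rewrite ?muln1.
Qed.

(** If the first nondoubling adds at most a quarter of the top, it costs a factor 5/8 against
    [2 ^ size s]. If it adds half of the top, it costs 3/4, and a second nondoubling adds at most
    2/3 of the top, for a total of 3/4 * 5/6 = 5/8. *)
Lemma star_top s : run [:: 1] 1 s ->
  [\/ nd 1 s = 0,
      exists A I, [/\ size s = A + I + 2, 1 + sumn s = 3 * 2 ^ (A + I),
        2 ^ A \in 1 :: scanl addn 1 s &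
        forall x, x \in 1 :: scanl addn 1 s ->
          (exists2 i, i <= A.+1 & x = 2 ^ i) \/
          (exists2 i, i <= I & x = 3 * 2 ^ (A + i))]
    | 8 * (1 + sumn s) <= 5 * 2 ^ size s].
Proof.
move=> r; case: (nd_split 1 s) => [|[s1 [b [s2 [sE nd1 bN]]]]]; first exact: Or31.
subst s; have [bl top1 [//|[B BA bE]]] := run_nd_mem _ _ _ _ r nd1 bN.
have r2 : 1 + sumn (s1 ++ b :: s2) <= 2 ^ size s2 * (2 ^ size s1 + b).
  move: r; rewrite run_cat /= top1 => /and4P[_ _ _ /run_leq].
  by rewrite sumn_cat /= !addnA top1.
case sz1 : (size s1) BA => [//|A]; rewrite ltnS leq_eqVlt => /predU1P[BA|BA].
  have Y : 1 + sumn s1 + b = 3 * 2 ^ A by rewrite top1 bE BA sz1 expnS; lia.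
  case: (nd_split (1 + sumn s1 + b) s2) => [nd2|[s3 [g [s4 [s2E nd3 gN]]]]].
    apply: Or32; exists A, (size s2); split.
    - by rewrite size_cat /= sz1; lia.
    - by rewrite sumn_cat /= !addnA nd_eq0 // Y expnD; lia.
    - rewrite scanl_addn_cat -cat_cons mem_cat.
      have /(nd0_mem _ _ (2 ^ A)) P := nd1.
      by rewrite (introT P) //; exists A; rewrite ?muln1 // sz1.
    - move=> x; rewrite scanl_addn_cat -cat_cons mem_cat /= => /orP[].
        case/(nd0_mem _ _ _ nd1) => i iA ->; left; exists i; rewrite ?muln1 //.
        by rewrite -sz1.
      case/(nd0_mem _ _ _ nd2) => i iA ->; right; exists i => //.
      by rewrite Y expnD; lia.
  apply: Or33.
  have gl : 3 * g <= 2 * (2 ^ size s3 * (3 * 2 ^ A)).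
    subst s2; have [//|[i iA ->]|[i iA ->]] := run_nd_mem2 _ _ _ _ _ _ r nd1 nd3 gN.
      have : 2 ^ i <= 2 ^ A.+1 by rewrite leq_pexp2l // -sz1.
      by have := expn_gt0 2 (size s3); rewrite expnS; nia.
    have : 2 ^ i.+1 <= 2 ^ size s3 by rewrite leq_pexp2l.
    by rewrite Y expnS; nia.
  have r4 : 1 + sumn (s1 ++ b :: s2) <=
      2 ^ size s4 * (2 ^ size s3 * (3 * 2 ^ A) + g).
    move: r; rewrite s2E run_cat /= run_cat /= => /and4P[_ _ _ /and4P[_ _ _]].
    move/run_leq; rewrite !sumn_cat /= sumn_cat /= !addnA.
    by rewrite (nd_eq0 _ _ nd3) Y.
  have szE : size (s1 ++ b :: s2) = A + (size s3 + size s4) + 3.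
    by rewrite s2E size_cat /= size_cat /= sz1; lia.
  rewrite szE !expnD; move: r4 gl.
  move: (2 ^ size s4) (2 ^ size s3) (2 ^ A) => x y z.
  move: (sumn _) => n; nia.
apply: Or33.
have : 2 ^ B.+2 <= 2 ^ A.+1 by rewrite leq_pexp2l.
rewrite size_cat /= sz1 addSnnS addnC !expnD; move: r2; rewrite sz1 bE !expnS.
move: (2 ^ size s2) (2 ^ B) (2 ^ A) (sumn _) => x y z n; nia.
Qed.

(** * One side element *)

(* The trunk leaves [c] for [c + b < c + d], so the side [c + d] is not free; the
   size of [n] leaves three ways out: [c + d] is [c + b] plus an available [g];
   [d = c], and then [c + d] and [c + b] exchange their roles; or
   [n = 5 * 2 ^ i + 1]. *)
Lemma scholz_gap s1 b e post c d :
  run [:: 1; c + d] 1 (s1 ++ b :: e :: c + d :: post) ->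
  run [:: 1] 1 s1 -> c = 1 + sumn s1 -> c + d \in post ->
  b \in 1 :: scanl addn 1 s1 -> d \in 1 :: scanl addn 1 s1 ->
  e \in c + b :: 1 :: scanl addn 1 s1 ->
  b < d <= c -> c + d < c + b + e ->
  5 * 2 ^ size s1 < c + b + e + 2 * (c + d) ->
  let n := 1 + sumn (s1 ++ b :: e :: c + d :: post) in
  odd n -> 5 * 2 ^ (size s1 + (size post + 3)) < 16 * n ->
  (forall i, n <> 5 * 2 ^ i + 1) ->
  ell (2 ^ n - 1) <= n + (size s1 + (size post + 3)).
Proof.
move=> r rs1 cE wpost bs1 ds1 es1 /andP[bd dc] wu big n no n16 n5.
have free g : c + d = c + b + g -> g \in 1 :: scanl addn 1 s1 ->
    ell (2 ^ n - 1) <= n + (size s1 + (size post + 3)).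
  move=> wE gs.
  have := scholz_side (s1 ++ [:: b]) e (c + d :: post) (c + b) g.
  rewrite -wE -!catA /= => /(_ r) h; apply: (leq_trans (h _ _ _)).
  - by rewrite sumn_cat /= cE addn0 addnA.
  - by rewrite scanl_addn_cat -cat_cons mem_cat gs.
  - by move: wu; rewrite wE ltn_add2l; apply: ltnW.
  - by rewrite size_cat /= /n; move: (sumn _) => S; clear; lia.
have ecb : e <= c + b.
  move: es1; rewrite inE => /predU1P[->//|/scanlP[t [t' [s1E ->]]]].
  by rewrite cE s1E sumn_cat addnA -addnA leq_addr.
have [nd1|[A [I [szE cI pA mem]]]|c5] := star_top _ rs1.
- have cX : c = 2 ^ size s1 by rewrite cE nd_eq0 // muln1.
  have mem x : x \in 1 :: scanl addn 1 s1 -> exists2 i, i <= size s1 & x = 2 ^ i.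
    by case/(nd0_mem _ _ _ nd1) => i ? ->; exists i; rewrite ?muln1.
  have mem' i : i <= size s1 -> 2 ^ i \in 1 :: scanl addn 1 s1.
    by move=> il; apply/(nd0_mem _ _ _ nd1); exists i; rewrite ?muln1.
  have [i iC bE] := mem _ bs1; have [j jC dE] := mem _ ds1.
  have ij : i < j by rewrite -(ltn_exp2l (m := 2)) // -bE -dE.
  case: (ltngtP i.+1 j) => [ij2||ji]; last first.
  + by apply: (free b) => //; rewrite dE bE -ji expnS; clear; lia.
  + by rewrite ltnNge ij.
  have bd4 : 4 * b <= d by rewrite bE dE -!(expnD 2 2) leq_exp2l.
  have eE : e = c + b \/ exists2 l, l <= size s1 & e = 2 ^ l.
    by move: es1; rewrite inE => /predU1P[|/mem]; [left | right].
  case: (ltngtP j (size s1)) => [jC2||jCE]; first 1 last.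
  + by rewrite ltnNge jC.
  + have dcE : d = c by rewrite dE jCE cX.
    (* The exchange: the side is [2 * c], so the trunk may pass through [c], [2 * c], [2 * c + g]
       instead of [c], [c + b], [c + b + e]. The new side [c + b] is free because [b <= c]. *)
    have [g gE gs] : exists2 g, c + g = b + e & g \in 1 :: scanl addn 1 s1.
      case: eE => [->|[l]].
        exists (2 ^ i.+1); first by rewrite bE expnS; clear; lia.
        by apply: mem'; apply: leq_trans ij jC.
      rewrite leq_eqVlt => /predU1P[->|lC] eE; first by exists b; rewrite // eE cX addnC.
      have : 2 * e <= c by rewrite eE cX -expnS leq_exp2l.
      by move: wu bd4; rewrite dcE; clear; lia.
    have nE : n = 1 + sumn (s1 ++ c :: g :: c + d :: post).
      by rewrite /n !sumn_cat /= (addnA b) (addnA c g) gE.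
    have := scholz_side s1 c (g :: c + d :: post) c b.
    rewrite -nE => h; apply: (leq_trans (h _ _ _ _)) => //; last 2 first.
    * exact: ltnW (leq_trans bd dc).
    * by rewrite size_cat /= nE; move: (sumn _) => S; clear; lia.
    move: r; rewrite !run_cat /= -cE => /and4P[_ bE' _ /and3P[eE' _ /and3P[_ wl r]]].
    have cs : c \in 1 :: scanl addn 1 s1 by rewrite cE mem_scanl_top.
    have sub x : x \in 1 :: scanl addn 1 s1 -> x \in scanl addn 1 s1 ++ [:: 1; c + b].
      by rewrite mem_cat !inE => /orP[->|->]; rewrite ?orbT.
    have eqE : c + c + g = c + b + e by rewrite -addnA gE addnA.
    have -> : run [:: 1; c + b] 1 s1.
      by apply: run_sub rs1 => x _; rewrite !inE => ->.
    rewrite sub // leqnn inE sub // orbT eqE /=; apply/and4P; split.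
    * by case/mem: gs => l lC ->; rewrite cX (leq_trans _ (leq_addr _ _)) // leq_exp2l.
    * by rewrite !inE dcE eqxx orbT.
    * exact: wl.
    apply: run_sub r => x _; rewrite !(inE, mem_cat) -dcE.
    by case/or4P=> [->|->|->|/or3P[->|->|->]]; rewrite ?orbT.
  have dc2 : 2 * d <= c by rewrite dE cX -expnS leq_exp2l.
  move: (r); rewrite (catA s1 [:: b; e]) run_cat => /andP[_].
  have -> : 1 + sumn (s1 ++ [:: b; e]) = c + b + e.
    by rewrite sumn_cat /= addn0 !addnA cE.
  move=> rt.
  have nE : c + b + e + sumn (c + d :: post) = n.
    by rewrite /n sumn_cat /= cE !addnA.
  (* The remaining trunk starts at [c + b + e] and adds the side at once and again later; no element
     other than its top exceeds [c + d]. *)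
  have := run_tail _ (c + d) _ _ _ rt; rewrite nE => tail.
  case: tail => //.
  + move=> x; rewrite scanl_addn_cat /= -cE -catA mem_cat !inE.
    have bnd y : y \in 1 :: scanl addn 1 s1 -> y <= c + d.
      by case/mem=> l lC ->; rewrite cX (leq_trans _ (leq_addr _ _)) // leq_exp2l.
    case/or4P=> [xs|/eqP->|/eqP->//|/orP[/eqP->|/eqP->//]] _.
    * by apply: bnd; rewrite inE xs orbT.
    * by move: bd; clear; lia.
    * exact: bnd (mem_head _ _).
  + by move: bd wu ecb; clear; lia.
  + move=> nE2; case: eE => [eE|[l]].
      by move: no; rewrite nE2 eE addnn -mul2n -mulnDr oddM.
    have n5c : 5 * c < n.
      have : 2 ^ 4 <= 2 ^ (size post + 3).
        by rewrite leq_exp2l // addn3 !ltnS; case: (post) wpost.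
      by move: n16; rewrite expnD -cX; move: (2 ^ _) (n) => *; nia.
    rewrite leq_eqVlt => /predU1P[->|lC] eE; last first.
      have : 2 * e <= c by rewrite eE cX -expnS leq_exp2l.
      by move: bd4 dc2 n5c; rewrite nE2; clear; lia.
    move: jC2; rewrite leq_eqVlt => /predU1P[jE|jC3]; last first.
      have : 4 * d <= c by rewrite dE cX -!(expnD 2 2) leq_exp2l.
      by move: bd4 n5c; rewrite nE2 eE -cX; clear; lia.
    have c2d : c = 2 * d by rewrite cX dE -expnS jE.
    (* As [c] is even and [n] odd, the power of two [b] is 1, and [n] has the excluded form. *)
    have {}nE2 : n = 5 * c + b by rewrite nE2 eE -cX c2d; clear; lia.
    move: no (n5 (size s1)); rewrite -cX nE2 bE {1}c2d mulnCA oddD oddM /=.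
    by case: (i) => // i'; rewrite expnS oddM.
  (* This would give [10 * c < 3 * (c + b + e) + 2 * (c + d)], but [e <= c + b], [4 * b <= d] and
     [2 * d <= c] bound the right side by 39/4 of [c]. *)
  + move=> n8; move: n16; rewrite !expnD -cX => n16.
    have P0 := expn_gt0 2 (size post).
    move: n8; rewrite /= expnS; move: (2 ^ size post) P0 n16 => P P0 n16 n8.
    have : P * (10 * c) < P * (3 * (c + b + e) + 2 * (c + d)).
      by move: n16 n8; move: (n) => m; clear; lia.
    by rewrite ltn_pmul2l //; move: ecb bd4 dc2; clear; lia.
(* Now [c = 3 * Z], and [big] forces [d = 3 * Z] and [b > Z]. Either [I = 0], [b = 2 * Z] and [free]
   applies to [g = Z], or [2 * b = 3 * Z] and it applies to [g = b]. *)
- rewrite -cE in cI; rewrite szE cI expnD in big; set Z := 2 ^ (A + I) in big.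
  have Zi i : i <= I -> 2 ^ (A + i) <= Z.
    by move=> iI; rewrite leq_exp2l // leq_add2l.
  have small i : i <= A.+1 -> 2 ^ i <= 2 * Z.
    by move=> iA; rewrite -expnS leq_exp2l // (leq_trans iA) // ltnS leq_addr.
  have half i : i < I -> 2 * 2 ^ (A + i) <= Z.
    by move=> iI; rewrite -expnS -addnS; apply: Zi.
  have dE : d = 3 * Z.
    have bd4 : 4 * Z < b + d by move: big ecb; rewrite cI -/Z; clear; lia.
    case: (mem _ ds1) => [[i /small]|[i]].
      by move=> + dE; rewrite -dE; move: bd bd4; clear; lia.
    rewrite leq_eqVlt => /predU1P[->//|/half + dE]; rewrite dE.
    by move: bd bd4; rewrite dE; clear; lia.
  have bZ : Z < b by move: big ecb; rewrite cI -/Z; clear -dE; lia.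
  case: (mem _ bs1) => [[i]|[i]].
    rewrite leq_eqVlt => /predU1P[-> bE|iA bE]; last first.
      by move: bZ; rewrite bE ltnNge leq_exp2l // (leq_trans _ (leq_addr I A)).
    case: I => [|I] in szE cI mem Z big Zi small half dE bZ *; last first.
      by move: bZ; rewrite bE ltnNge leq_exp2l // addnS ltnS leq_addr.
    by apply: (free _ _ pA); rewrite cI dE bE /Z addn0 expnS; clear; lia.
  rewrite leq_eqVlt => /predU1P[-> bE|]; first by move: bd; rewrite bE dE ltnn.
  rewrite leq_eqVlt => /predU1P[iI bE|iI bE]; last first.
    by have := half _ iI; rewrite addnS expnS; move: bZ; rewrite bE; clear; lia.
  apply: (free b) => //; rewrite cI dE bE /Z -iI addnS expnS; clear; lia.
(* The left side of [big] is at least [8 * c], the right side less than that, by [e <= c + b] and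
   [b < d <= c]. *)
- by move: big c5 bd dc ecb; rewrite -cE; clear; lia.
Qed.

Lemma split_first (x : nat) s : x \in s ->
  exists s1 s2, s = s1 ++ x :: s2 /\ x \notin s1.
Proof.
elim: s => //= y s IH; case: (eqVneq x y) => [-> _|xy].
  by exists [::], s.
rewrite inE (negPf xy) => /IH[s1 [s2 [-> xs1]]].
by exists (y :: s1), s2; rewrite inE negb_or xy.
Qed.

Lemma scholz_one s c d :
  run [:: 1; c + d] 1 s -> c \in 1 :: scanl addn 1 s ->
  d \in 1 :: scanl addn 1 s -> odd (1 + sumn s) ->
  5 * 2 ^ size s < 16 * (1 + sumn s) ->
  (forall i, 1 + sumn s <> 5 * 2 ^ i + 1) ->
  ell (2 ^ (1 + sumn s) - 1) <= sumn s + size s + 1.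
Proof.
wlog dc : c d / d <= c.
  move=> H r cs ds; case/orP: (leq_total d c) => [dc|cd]; first exact: H r cs ds.
  by apply: H cd _ ds cs; rewrite addnC.
move=> r cs ds no n16 n5.
have d0 := scanl_geq _ _ _ ds.
have pos : 0 \notin s by apply: run_pos r _ _; rewrite ?inE //; lia.
case: (boolP (c + d \in s)) => [/split_first[pre [post [sE wpre]]]|ws]; last first.
  apply: leq_trans (leq_addr 1 _); apply: scholz_star.
  apply: run_sub r => x xs; rewrite !inE => /orP[->//|/eqP xE].
  by rewrite -xE xs in ws.
subst s; move: (r); rewrite run_cat /= => /and4P[rpre wE wu' rpost].
have pos2 : 0 \notin c + d :: post by move: pos; rewrite mem_cat negb_or => /andP[].
have cpre : c \in 1 :: scanl addn 1 pre by apply: scanl_leq pos2 cs _; lia.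
have dpre : d \in 1 :: scanl addn 1 pre by apply: scanl_leq pos2 ds _; lia.
have sumE x y : sumn (pre ++ x :: y) = sumn pre + (x + sumn y) by rewrite sumn_cat.
case: (boolP (c + d \in post)) => [wpost|wpost]; last first.
  have /scholz_star : run [:: 1] 1 (pre ++ c :: d :: post).
    apply: run_split r wpre wpost _ _ _.
    - by move=> x; rewrite !inE orbC.
    - by rewrite mem_cat inE orbC -in_cons.
    - by rewrite mem_cat inE orbC -in_cons.
  rewrite (_ : sumn _ = sumn (pre ++ c + d :: post)); last first.
    by rewrite !sumn_cat /= !addnA.
  by rewrite !size_cat /= !addnS addn0.
case: (eqVneq (c + d) (1 + sumn pre)) => [wE'|wN].
  apply: leq_trans (leq_addr 1 _); apply: scholz_star.
  apply: run_dup r _ _ _; rewrite -?wE' ?mem_head //.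
  by move=> x; rewrite !inE orbC.
have {wN} wu : c + d < 1 + sumn pre by rewrite ltn_neqAle wN.
have {}rpre : run [:: 1] 1 pre.
  apply: run_sub rpre => x xs; rewrite !inE => /orP[->//|/eqP xE].
  by rewrite -xE xs in wpre.
(* Two additions of the side after [pre] are compared with the lower bound on [n]. *)
have big : 5 * 2 ^ size pre < 4 * (1 + sumn pre + 2 * (c + d)).
  have r2 : run (scanl addn 1 pre ++ [:: 1; c + d]) (1 + sumn pre) (c + d :: post).
    by rewrite /= wE wu'.
  have := run_leq_count _ _ _ (c + d) 2 r2; rewrite /= eqxx add1n ltnS -has_count.
  rewrite has_pred1 => /(_ wpost) h.
  have : 2 ^ (size post).+1 * (5 * 2 ^ size pre) <
         2 ^ (size post).+1 * (4 * (1 + sumn pre + 2 * (c + d))).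
    move: n16 h; rewrite sumE size_cat /= expnD.
    move: (2 ^ (size post).+1) (2 ^ size pre) (sumn pre) (sumn post) => x y p q.
    clear; lia.
  by rewrite ltn_mul2l => /andP[].
case/scanlP: (cpre) => s1 [[|b s2] [preE cE]].
  by move: wu; rewrite preE cats0 -cE ltnNge leq_addr.
subst pre; rewrite -!catA /= in r pos no n5 n16 sumE *.
have ds1 : d \in 1 :: scanl addn 1 s1.
  apply: scanl_leq dpre _; last by rewrite -cE.
  by move: pos; rewrite !mem_cat !inE !mem_cat !inE !negb_or => /and3P[_ -> /andP[->]].
case: (leqP d b) => [db|bd].
  exact: scholz_side r cE ds1 db.
move: rpre; rewrite run_cat /= -cE => /and4P[rs1 bE bc rs2].
have bs1 : b \in 1 :: scanl addn 1 s1 by move: bE; rewrite mem_cat inE orbC.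
have topE : 1 + sumn (s1 ++ b :: s2) = c + b + sumn s2.
  by rewrite sumn_cat /= cE !addnA.
have ru := run_leq _ _ _ rs2; rewrite topE size_cat /= in wu big.
have star := star_top _ rs1; rewrite -cE in star.
have pows : nd 1 s1 = 0 -> exists i j,
    [/\ b = 2 ^ i, d = 2 ^ j, c = 2 ^ size s1, i < j & j <= size s1].
  move=> nd1; have cX : c = 2 ^ size s1 by rewrite cE nd_eq0 // muln1.
  case/(nd0_mem _ _ _ nd1): bs1 => i _; rewrite muln1 => bE'.
  case/(nd0_mem _ _ _ nd1): ds1 => j jC; rewrite muln1 => dE'.
  exists i, j; split=> //.
  by rewrite -(ltn_exp2l (m := 2)) // -bE' -dE'.
(* The trunk must pass [c + d > c + b], so [s2] is not empty. Two or more steps would give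
   [5 * 2 ^ size s1 < 3 * c + 2 * b + d], which [star] excludes. *)
have [e s2E] : exists e, s2 = [:: e].
  case: (s2) ru wu big => [|e [|f t]] /=; last first.
  - move=> ru wu big.
    have : c = 2 ^ size s1 /\ 2 * b <= d \/ 4 * c <= 3 * 2 ^ size s1.
      case: star => [/pows[i [j [-> -> -> ij _]]]|[A [I [-> -> _ _]]]|c5].
      - by left; split=> //; rewrite -expnS leq_exp2l.
      - by right; rewrite addn2 !expnS; clear; lia.
      - by right; move: c5; clear; lia.
    move: ru big wu bd dc; rewrite !addnS !expnS expnD.
    move: (2 ^ size s1) (2 ^ size t) (sumn t) (expn_gt0 2 (size t)) => X Y S Y0.
    have := leq_pmull (c + d) Y0.
    clear -Y0 => cdY ru big _ bd dc H.
    have : Y * (5 * X) < Y * (3 * c + 2 * b + d) by lia.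
    by rewrite ltn_pmul2l //; clear -bd dc H; lia.
  - by move=> *; exists e.
  - by rewrite addn0 ltn_add2l ltnNge (ltnW bd).
subst s2; rewrite /= addn0 in wu big.
have gap : 5 * 2 ^ size s1 < c + b + e + 2 * (c + d).
  by move: big; rewrite addn2 !expnS; clear; lia.
have es1 : e \in c + b :: 1 :: scanl addn 1 s1.
  case/and3P: rs2; rewrite !(inE, mem_cat) => /or3P[->|->|->] *;
    by rewrite ?orbT.
have bdc : b < d <= c by rewrite bd.
have szE : size s1 + (size post + 3) = size (s1 ++ b :: e :: c + d :: post).
  by rewrite size_cat /= addn3.
have := scholz_gap _ _ _ _ _ _ r rs1 cE wpost bs1 ds1 es1 bdc wu gap.
rewrite /= szE => /(_ no n16 n5)/leq_trans; apply.
by rewrite add1n addSn addn1.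
Qed.

(** * Two side elements *)

Lemma pow2_sum_gap i j s :
  2 ^ i + 2 ^ j < 2 ^ s -> 4 * (2 ^ i + 2 ^ j) <= 3 * 2 ^ s.
Proof.
wlog ij : i j / i <= j.
  move=> H; case/orP: (leq_total i j) => [/H//|/H]; rewrite addnC; exact.
move=> lt; have js : j < s.
  by rewrite -(ltn_exp2l (m := 2)) //; move: lt; clear; lia.
have : 2 ^ i <= 2 ^ j by rewrite leq_exp2l.
have : 2 * 2 ^ j <= 2 ^ s by rewrite -expnS leq_exp2l.
move: js; rewrite leq_eqVlt => /predU1P[sE|js2].
  move: lt; rewrite -sE expnS => lt _ le.
  have : i < j by rewrite -(ltn_exp2l (m := 2)) //; move: lt le; clear; lia.
  by rewrite -(leq_exp2l (m := 2)) // expnS; clear; lia.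
have : 4 * 2 ^ j <= 2 ^ s by rewrite -(expnD 2 2) leq_exp2l.
by clear; lia.
Qed.

(** The largest sums of two powers of two below [2 ^ s] are 3/4 and 5/8 of it, and 2/3 lies
    between. *)
Lemma pow2_sum_large i j s :
  2 ^ i + 2 ^ j < 2 ^ s -> 2 * 2 ^ s < 3 * (2 ^ i + 2 ^ j) ->
  exists2 a, s = a.+2 & 2 ^ i + 2 ^ j = 3 * 2 ^ a.
Proof.
wlog ij : i j / i <= j.
  move=> H; case/orP: (leq_total i j) => [/H//|/H]; rewrite addnC; exact.
move=> lt gt; have js : j < s.
  by rewrite -(ltn_exp2l (m := 2)) //; move: lt; clear; lia.
have le : 2 ^ i <= 2 ^ j by rewrite leq_exp2l.
have sE : s = j.+1.
  move: js; rewrite leq_eqVlt => /predU1P[//|js2].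
  have : 4 * 2 ^ j <= 2 ^ s by rewrite -(expnD 2 2) leq_exp2l.
  by move: gt le; clear; lia.
subst s; rewrite expnS in lt gt.
have {}ij : i < j by rewrite -(ltn_exp2l (m := 2)) //; move: lt; clear; lia.
case: j ij js le lt gt => // j; rewrite ltnS leq_eqVlt => /predU1P[->|ij] _ _ _ gt.
  by exists j => //; rewrite expnS; clear; lia.
have : 2 * 2 ^ i <= 2 ^ j by rewrite -expnS leq_exp2l.
by move: gt; rewrite expnS; clear; lia.
Qed.

(** If [pre] only doubles, [run_tail] makes [n] even or too small. Otherwise its only nondoubling
    adds [w], equal to 3/4 of the top, and no two available elements sum into the narrow window that
    growth leaves for [c + d] below the top of [pre]. *)
Lemma two_sides_absurd pre post w c1 d1 c d :
  run [:: 1; c + d; w] 1 (pre ++ c + d :: post) ->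
  run [:: 1; w] 1 pre -> c + d \in post ->
  w = c1 + d1 ->
  c1 \in 1 :: scanl addn 1 (pre ++ c + d :: post) ->
  d1 \in 1 :: scanl addn 1 (pre ++ c + d :: post) ->
  c \in w :: 1 :: scanl addn 1 pre -> d \in w :: 1 :: scanl addn 1 pre ->
  c + d < 1 + sumn pre -> odd (1 + sumn (pre ++ c + d :: post)) ->
  5 * 2 ^ size (pre ++ c + d :: post) < 8 * (1 + sumn (pre ++ c + d :: post)) ->
  False.
Proof.
move=> r rpre wpost wE c1s d1s cpre dpre wu no n8.
have c1_gt0 := scanl_geq _ _ _ c1s; have d1_gt0 := scanl_geq _ _ _ d1s.
have gt0 x : x \in w :: 1 :: scanl addn 1 pre -> 0 < x.
  rewrite inE => /predU1P[->|/scanl_geq//].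
  by rewrite wE addn_gt0 c1_gt0.
have c_gt0 := gt0 _ cpre; have d_gt0 := gt0 _ dpre.
have pos : 0 \notin pre ++ c + d :: post.
  apply: run_pos r _ _ => //; rewrite !inE wE.
  by move: c_gt0 c1_gt0; clear; lia.
have nE : 1 + sumn pre + sumn (c + d :: post) = 1 + sumn (pre ++ c + d :: post).
  by rewrite sumn_cat addnA.
move: (r); rewrite run_cat => /andP[_ rt].
have big : 5 * 2 ^ size pre < 2 * (1 + sumn pre + 2 * (c + d)).
  have := run_leq_count _ _ _ (c + d) 2 rt; rewrite nE /= eqxx add1n ltnS -has_count.
  rewrite has_pred1 => /(_ wpost); move: n8; rewrite size_cat /= expnD.
  have := expn_gt0 2 (size post).+1; rewrite orTb.
  move: (2 ^ (size post).+1) (2 ^ size pre) (sumn _) (sumn _) => P X n u P0 n8 h.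
  by rewrite -(ltn_pmul2l P0); move: n8 h; clear; lia.
have [nd0|[s1 [b [s2 [preE nd1 bN]]]]] := nd_split 1 pre.
  have uE : 1 + sumn pre = 2 ^ size pre by rewrite nd_eq0 // muln1.
  have pows x : x \in 1 :: scanl addn 1 pre -> exists2 i, i <= size pre & x = 2 ^ i.
    by case/(nd0_mem _ _ _ nd0) => i ? ->; exists i; rewrite ?muln1.
  have wX : w <= 2 ^ size pre.
    move: cpre dpre; rewrite inE => /predU1P[<- _|/pows[i _ cE]].
      by move: wu; rewrite uE; clear; lia.
    rewrite inE => /predU1P[<-|/pows[j _ dE]].
      by move: wu; rewrite uE; clear; lia.
    move: wu big; rewrite uE cE dE => /pow2_sum_gap.
    by clear; lia.
  have := run_tail _ (2 ^ size pre) _ _ _ rt; rewrite nE uE => tail.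
  case: tail => //.
  - move=> x; rewrite !(inE, mem_cat) => /or4P[xs|/eqP->|/eqP->|/eqP->//] _.
    + have [|i ii ->] := pows x; first by rewrite inE xs orbT.
      by rewrite leq_exp2l.
    + by rewrite expn_gt0.
    + by move: wu; rewrite uE; clear; lia.
  - by rewrite leqnn leq_pmull.
  - by rewrite -uE.
  - move=> nE2; move: no wu; rewrite nE2 uE oddD oddM addbF.
    by case: (size pre) => [|k]; rewrite ?expnS ?oddM //; move: c_gt0; clear; lia.
  - move: n8; rewrite size_cat expnD /=.
    by move: (_ ^ _) (2 ^ _) (sumn _) => X P n; clear; lia.
subst pre; rewrite -catA /= in r pos.
have [bl topE bE] := run_nd_mem _ _ _ _ rpre nd1 bN.
have uleq : 1 + sumn (s1 ++ b :: s2) <= 2 ^ size s2 * (2 ^ size s1 + b).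
  move: rpre; rewrite run_cat /= topE => /and4P[_ _ _ /run_leq].
  by rewrite sumn_cat /= !addnA topE.
have b23 : 2 * 2 ^ size s1 < 3 * b.
  move: big wu uleq; rewrite size_cat /= expnD expnS.
  have := expn_gt0 2 (size s2); rewrite orTb.
  move: (2 ^ size s1) (2 ^ size s2) (sumn _) => X Q n Q0 big wu uleq.
  rewrite -(ltn_pmul2l Q0); move: big wu uleq; clear; lia.
have {bE} bE : b = w.
  case: bE => [|[i iA bE]]; first by rewrite inE => /eqP.
  have : 2 * b <= 2 ^ size s1 by rewrite bE -expnS leq_exp2l.
  by move: b23; clear; lia.
subst b.
have pos2 : 0 \notin w :: s2 ++ c + d :: post.
  by move: pos; rewrite mem_cat negb_or => /andP[].
have pow1 x : x \in 1 :: scanl addn 1 ((s1 ++ w :: s2) ++ c + d :: post) ->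
    x <= w -> exists i, x = 2 ^ i.
  rewrite -catA => xs xw; have : x \in 1 :: scanl addn 1 s1.
    by apply: scanl_leq pos2 xs _; rewrite topE (leq_trans xw) // ltnW.
  by case/(nd0_mem _ _ _ nd1) => i _ ->; exists i; rewrite muln1.
have [a sz1 wZ] : exists2 a, size s1 = a.+2 & w = 3 * 2 ^ a.
  have [||i c1E] := pow1 c1; rewrite ?c1s ?wE ?leq_addr //.
  have [||j d1E] := pow1 d1; rewrite ?d1s ?wE ?leq_addl //.
  by rewrite c1E d1E; apply: pow2_sum_large; rewrite -c1E -d1E -wE.
have YE : 1 + sumn s1 + w = 7 * 2 ^ a.
  by rewrite topE wZ sz1 !expnS; clear; lia.
have Z0 := expn_gt0 2 a; rewrite orTb in Z0.
have [nd2|[s3 [g [s4 [s2E nd3 gN]]]]] := nd_split (1 + sumn s1 + w) s2; last first.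
  subst s2; have gl := run_nd_mem2 _ _ _ _ _ _ rpre nd1 nd3 gN.
  have := expn_gt0 2 (size s3); rewrite orTb => P0.
  have {}gl : 2 * g <= 8 * (2 ^ size s3 * 2 ^ a).
    case: gl => [|[i iA ->]|[i iA ->]].
    - by rewrite inE => /eqP->; rewrite wZ; move: P0; clear; nia.
    - have : 2 ^ i <= 4 * 2 ^ a by rewrite -(expnD 2 2) leq_exp2l // add2n -sz1.
      by move: P0; clear; nia.
    - have : 2 * 2 ^ i <= 2 ^ size s3 by rewrite -expnS leq_exp2l.
      by rewrite YE; clear; nia.
  have u4 : 1 + sumn (s1 ++ w :: s3 ++ g :: s4) <=
      2 ^ size s4 * (2 ^ size s3 * (7 * 2 ^ a) + g).
    move: rpre; rewrite run_cat /= run_cat /= => /and4P[_ _ _ /and4P[_ _ _]].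
    move/run_leq; rewrite !sumn_cat /= sumn_cat /= !addnA.
    by rewrite (nd_eq0 _ _ nd3) YE.
  move: big wu; rewrite size_cat /= size_cat /= sz1 !addnS !addSn !expnS !expnD.
  have := expn_gt0 2 (size s4); rewrite orTb.
  move: u4 gl; move: (2 ^ size s4) (2 ^ size s3) (2 ^ a) (sumn _) => P Q Z n.
  move=> u4 gl P_gt0 big wu.
  have : P * (40 * (Q * Z)) < P * (3 * (Q * (7 * Z) + g)).
    by move: u4 big wu; clear; lia.
  by rewrite ltn_pmul2l //; move: gl; clear; lia.
have uE : 1 + sumn (s1 ++ w :: s2) = 2 ^ size s2 * (7 * 2 ^ a).
  by rewrite sumn_cat /= !addnA nd_eq0 // YE.
(* So [c + d] lies strictly between 13/14 of the top and the top. *)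
have big2 : 13 * (2 ^ size s2 * 2 ^ a) < 2 * (c + d).
  move: big; rewrite uE size_cat /= sz1 !addSn addnS !expnS expnD.
  by clear; lia.
have elt x : x \in w :: 1 :: scanl addn 1 (s1 ++ w :: s2) ->
    x < 1 + sumn (s1 ++ w :: s2) ->
    [\/ x = 3 * 2 ^ a, exists2 i, i <= a.+2 & x = 2 ^ i
      | exists2 i, i < size s2 & x = 2 ^ i * (7 * 2 ^ a)].
  rewrite inE => /predU1P[->|]; first by rewrite wZ => _; apply: Or31.
  rewrite scanl_addn_cat -cat_cons mem_cat => /orP[|].
    case/(nd0_mem _ _ _ nd1) => i iA ->; rewrite muln1 => _.
    by apply: Or32; exists i; rewrite -?sz1.
  case/(nd0_mem _ _ _ nd2) => i iA ->; rewrite uE YE => lt.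
  apply: Or33; exists i => //.
  by move: lt; rewrite ltn_pmul2r ?muln_gt0 // ltn_exp2l.
have cu : c < 1 + sumn (s1 ++ w :: s2) by move: wu d_gt0; clear; lia.
have du : d < 1 + sumn (s1 ++ w :: s2) by move: wu c_gt0; clear; lia.
case: (size s2) uE big2 elt => [|q] uE big2 elt.
  have elt0 x : x \in w :: 1 :: scanl addn 1 (s1 ++ w :: s2) ->
      x < 1 + sumn (s1 ++ w :: s2) ->
      [\/ x = 3 * 2 ^ a, x = 4 * 2 ^ a | x <= 2 * 2 ^ a].
    move=> /elt/[apply] -[->|[i]|[//]]; first exact: Or31.
    rewrite leq_eqVlt => /predU1P[->|iA] ->.
      by apply: Or32; rewrite -(expnD 2 2).
    by apply: Or33; rewrite -expnS leq_exp2l.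
  move: wu big2; rewrite uE.
  by case: (elt0 _ cpre cu) (elt0 _ dpre du) => + []; clear; lia.
have elt1 x : x \in w :: 1 :: scanl addn 1 (s1 ++ w :: s2) ->
    x < 1 + sumn (s1 ++ w :: s2) ->
    x = 7 * (2 ^ q * 2 ^ a) \/ x <= 4 * (2 ^ q * 2 ^ a).
  have P0 : 2 ^ a <= 2 ^ q * 2 ^ a by rewrite leq_pmull // expn_gt0.
  move=> /elt/[apply] -[->|[i iA ->]|[i]].
  - by right; move: P0; clear; lia.
  - right; have : 2 ^ i <= 4 * 2 ^ a by rewrite -(expnD 2 2) leq_exp2l.
    by move: P0; clear; lia.
  - rewrite ltnS leq_eqVlt => /predU1P[->|iq] ->; first by left; clear; lia.
    right; have : 2 * 2 ^ i <= 2 ^ q by rewrite -expnS leq_exp2l.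
    by clear; nia.
move: wu big2; rewrite uE expnS.
by case: (elt1 _ cpre cu) (elt1 _ dpre du) => + []; clear; lia.
Qed.

(** The later side is removed at the cost of at most one trunk step, which is why 8 stands here
    where [scholz_one] has 16. The trunk keeps its old elements, so [c1] and [d1] stay available. *)
Lemma scholz_two s w c1 d1 c d :
  run [:: 1; c + d; w] 1 s -> w = c1 + d1 ->
  c1 \in 1 :: scanl addn 1 s -> d1 \in 1 :: scanl addn 1 s ->
  c \in w :: 1 :: scanl addn 1 s -> d \in w :: 1 :: scanl addn 1 s ->
  odd (1 + sumn s) -> 5 * 2 ^ size s < 8 * (1 + sumn s) ->
  (forall i, 1 + sumn s <> 5 * 2 ^ i + 1) ->
  ell (2 ^ (1 + sumn s) - 1) <= sumn s + size s + 2.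
Proof.
move=> r wE c1s d1s cs ds no n8 n5.
have reduce t : run [:: 1; w] 1 t -> sumn t = sumn s -> size t <= (size s).+1 ->
    {subset scanl addn 1 s <= scanl addn 1 t} ->
    ell (2 ^ (1 + sumn s) - 1) <= sumn s + size s + 2.
  move=> rt sumE sizeE sub.
  have sub1 x : x \in 1 :: scanl addn 1 s -> x \in 1 :: scanl addn 1 t.
    by rewrite !inE => /orP[->//|/sub->]; rewrite orbT.
  rewrite wE in rt; have := scholz_one _ _ _ rt (sub1 _ c1s) (sub1 _ d1s).
  rewrite sumE => /(_ no _ n5) h; apply: (leq_trans (h _)).
    apply: (@leq_ltn_trans (5 * 2 ^ (size s).+1)).
      by rewrite leq_mul2l leq_exp2l.
    by rewrite expnS; move: n8; move: (2 ^ _) => X; clear; lia.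
  by move: sizeE; clear; lia.
have noside t : c + d \notin t ->
    forall x, x \in t -> x \in [:: 1; c + d; w] -> x \in [:: 1; w].
  move=> nt x xt; rewrite !inE orbCA => /predU1P[xE|//].
  by rewrite -xE xt in nt.
have c1_gt0 := scanl_geq _ _ _ c1s; have d1_gt0 := scanl_geq _ _ _ d1s.
have gt0 x : x \in w :: 1 :: scanl addn 1 s -> 0 < x.
  rewrite inE => /predU1P[->|/scanl_geq//].
  by rewrite wE addn_gt0 c1_gt0.
have c_gt0 := gt0 _ cs; have d_gt0 := gt0 _ ds.
case: (boolP (c + d \in s)) => [/split_first[pre [post [sE wpre]]]|ws]; last first.
  by apply: (reduce s) => //; apply: run_sub r; apply: noside.
subst s; move: (r); rewrite run_cat /= => /and4P[rpre _ wu _].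
have pos : 0 \notin pre ++ c + d :: post.
  apply: run_pos r _ _ => //; rewrite !inE wE.
  by move: c_gt0 c1_gt0; clear; lia.
have pos2 : 0 \notin c + d :: post.
  by move: pos; rewrite mem_cat negb_or => /andP[].
have mem_pre x : x \in w :: 1 :: scanl addn 1 (pre ++ c + d :: post) ->
    x <= 1 + sumn pre -> x \in w :: 1 :: scanl addn 1 pre.
  rewrite inE => /predU1P[->|xs xu]; first by rewrite mem_head.
  by rewrite inE (scanl_leq _ _ _ _ pos2 xs xu) orbT.
have cpre := mem_pre _ cs (leq_trans (leq_addr _ _) wu).
have dpre := mem_pre _ ds (leq_trans (leq_addl _ _) wu).
case: (boolP (c + d \in post)) => [wpost|wpost]; last first.
  apply: (reduce (pre ++ c :: d :: post)).
  - apply: run_split r wpre wpost _ _ _.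
    + by move=> x; rewrite !inE orbCA.
    + by move: cpre; rewrite !(inE, mem_cat) => /or3P[->|->|->]; rewrite ?orbT.
    + by move: dpre; rewrite !(inE, mem_cat) => /or3P[->|->|->]; rewrite ?orbT.
  - by rewrite !sumn_cat /= !addnA.
  - by rewrite !size_cat /= !addnS.
  - move=> x; rewrite !scanl_addn_cat /= !mem_cat !inE !addnA.
    by case/or3P=> ->; rewrite ?orbT.
case: (eqVneq (c + d) (1 + sumn pre)) => [wE'|wN].
  apply: (reduce (pre ++ c + d :: post)) => //.
  apply: run_dup r _ _ _; rewrite -?wE' ?mem_head //.
  by move=> x; rewrite !inE orbCA.
have {wN} wu' : c + d < 1 + sumn pre by rewrite ltn_neqAle wN.
have {}rpre : run [:: 1; w] 1 pre by apply: run_sub rpre; apply: noside.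
by case: (two_sides_absurd _ _ _ _ _ _ _ r rpre wpost wE c1s d1s cpre dpre wu' no n8).
Qed.

Lemma scholz_three_small n r E :
  has_addition_chain n r -> odd n -> 5 * 2 ^ E + 1 < n -> n < 10 * 2 ^ E ->
  r <= E + 5 -> ell (2 ^ n - 1) <= r + n - 1.
Proof.
move=> [a chn] no ngt nlt rE.
have [s [W [rs sE szE bW _]]] := trunk_of_chain _ _ _ _ chn (leqnn r).
have {}sE : 1 + sumn s = n by case: chn sE => _ _ _ <-.
have n5 i : 1 + sumn s <> 5 * 2 ^ i + 1.
  rewrite sE => nE; case: (leqP i E) => iE.
    have : 2 ^ i <= 2 ^ E by rewrite leq_exp2l.
    by move: ngt; rewrite nE; clear; lia.
  have : 2 * 2 ^ E <= 2 ^ i by rewrite -expnS leq_exp2l.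
  by move: nlt; rewrite nE; clear; lia.
have sT : size s + size W <= E + 5 by rewrite szE.
suff : ell (2 ^ (1 + sumn s) - 1) <= sumn s + size s + size W.
  by rewrite sE -szE -sE; clear; lia.
rewrite -sE in no ngt.
(* One side leaves at most [E + 4] trunk steps and two leave [E + 3], as the size hypotheses
   require; with three, [n <= 2 ^ (E + 2)] is too small. *)
case: W rs szE bW sT => [|w [|w1 [|? W]]] rs szE bW sT.
- by rewrite addn0; apply: scholz_star.
- case: bW => [[c [d [cs ds wE]]] _]; rewrite wE in rs.
  apply: (scholz_one _ _ _ rs) => //.
  have : 2 ^ size s <= 2 ^ (E + 4) by rewrite leq_exp2l //; move: sT => /=; clear; lia.
  by rewrite expnD; move: ngt; clear; lia.
- case: bW => [[c [d [cs ds wE]]] [[c1 [d1 [c1s d1s w1E]]] _]]; rewrite wE in rs.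
  apply: (scholz_two _ _ _ _ _ _ rs w1E) => //.
  have : 2 ^ size s <= 2 ^ (E + 3) by rewrite leq_exp2l //; move: sT => /=; clear; lia.
  by rewrite expnD; move: ngt; clear; lia.
- have := run_leq _ _ _ rs; rewrite muln1.
  have : 2 ^ size s <= 2 ^ (E + 2) by rewrite leq_exp2l //; move: sT => /=; clear; lia.
  by rewrite expnD; move: ngt; clear; lia.
Qed.

(** * The given exponents *)

(* Star chains of length [t] for [u] that contain 3. *)
Definition star13 (u t : nat) : Prop := exists s,
  [/\ run [:: 1] 1 s, 1 + sumn s = u, size s = t & 3 \in scanl addn 1 s].

Lemma star13_step u t x :
  star13 u t -> x \in [:: u; 1; 3] -> x <= u -> star13 (u + x) t.+1.
Proof.
move=> [s [r uE tE s3]] xu ux; exists (s ++ [:: x]); split.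
- rewrite run_cat r /= uE ux !andbT.
  rewrite mem_cat; move: xu; rewrite !inE => /or3P[/eqP->|/eqP->|/eqP->].
  - by move: (mem_scanl_top 1 s); rewrite uE inE orbC.
  - by rewrite eqxx orbT.
  - by rewrite s3.
- by rewrite sumn_cat /= addn0 addnA uE.
- by rewrite size_cat addn1 tE.
- by rewrite scanl_addn_cat mem_cat s3.
Qed.

Lemma star13_double u t k : star13 u t -> star13 (2 ^ k * u) (t + k).
Proof.
move=> su; elim: k => [|k IH]; first by rewrite mul1n addn0.
by rewrite addnS expnS -mulnA mul2n -addnn; apply: star13_step; rewrite ?mem_head.
Qed.

Theorem theorem8 (m k n : nat) (hm : 1 <= m) (hk : 3 <= k)
  (hn : n = 2 ^ (2 * m + k + 7) + 2 ^ (2 * m + k + 5) + 2 ^ (m + k + 4)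
          + 2 ^ (m + k + 3) + 2 ^ (m + 2) + 2 ^ (m + 1) + 1) :
  ell (2 ^ n - 1) <= ell n + n - 1.
Proof.
have X2 : 2 ^ (m + 2) = 2 * 2 ^ (m + 1) by rewrite addnS expnS.
have E1 : 2 ^ (2 * m + k + 5) = 2 ^ (m + 1) * (2 ^ (k + 2) * 2 ^ (m + 2)).
  by rewrite -!expnD; congr (2 ^ _); lia.
(* Horner form of the binary expansion with blocks 101, 11, 11, 1; the star chain below follows
   it. *)
have nE : n = 2 ^ (m + 1) * (2 ^ (k + 2) * (2 ^ (m + 2) * 5 + 3) + 3) + 1.
  have E2 : 2 ^ (m + k + 3) = 2 ^ (m + 1) * 2 ^ (k + 2).
    by rewrite -!expnD; congr (2 ^ _); lia.
  have -> : n = 5 * 2 ^ (2 * m + k + 5) + 3 * 2 ^ (m + k + 3) + 3 * 2 ^ (m + 1) + 1.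
    rewrite hn X2 (_ : 2 * m + k + 7 = 2 + (2 * m + k + 5)); last by lia.
    by rewrite (_ : m + k + 4 = 1 + (m + k + 3)) ?(expnD _ _ (_ + _)); lia.
  by rewrite E1 E2; move: (2 ^ _) (2 ^ _) (2 ^ _) => X Y Z; clear; lia.
have gt0 i := expn_gt0 2 i.
have no : odd n by rewrite nE addn1 /= oddM addn1 expnS oddM.
case: (leqP (ell n) (2 * m + k + 5 + 5)) => [le|gt].
  apply: scholz_three_small le => //.
  - by apply: ell_chain; rewrite nE addn1.
  - rewrite nE E1; have := gt0 (m + 1); have := gt0 (k + 2).
    by rewrite !orTb; clear; nia.
  - rewrite nE E1 X2; have := gt0 (m + 1); have := gt0 (k + 2).
    by rewrite !orTb; clear; nia.
(* Here [ell n] is at least [2 * m + k + 11], the length of the star chain built from 1, 2, 3, 5. *)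
have star5 : star13 5 3 by exists [:: 1; 1; 2].
have [s [r sE szE _]] : star13 n (2 * m + k + 11).
  rewrite nE (_ : 2 * m + k + 11 = (((3 + (m + 2)).+1 + (k + 2)).+1 + (m + 1)).+1);
    last by lia.
  apply: star13_step; rewrite ?inE ?eqxx ?orbT //; last first.
    by rewrite muln_gt0 gt0 addn_gt0 orbT.
  apply: star13_double; apply: star13_step; rewrite ?inE ?eqxx ?orbT //; last first.
    by rewrite (leq_trans _ (leq_pmull _ _)) ?gt0 // leq_addl.
  apply: star13_double; apply: star13_step; rewrite ?inE ?eqxx ?orbT //; last first.
    by rewrite (leq_trans _ (leq_pmull _ _)) ?gt0.
  exact: star13_double.
have := scholz_star _ r; rewrite sE szE => /leq_trans; apply.
by move: gt sE; clear; lia.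
Qed.
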